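(* (i) For all integers $m\ge1$, $n\ge 2$ and all real $\alpha\notin\pi\mathbb{Z}$, $$S(m,n,\alpha)=\operatorname{Tr}\big((\cot\alpha\, J_n+B_n)^m\big).$$ (ii) For each $m\ge 1$ there are polynomials $p_{m,m-2k}(x)$, $0\le k\le\lfloor m/2\rfloor$, with rational coefficients, integer-valued and independent of $n$ and $\alpha$, such that for all $n\ge2$ and all real $\alpha\notin\pi\mathbb{Z}$ $$S(m,n,\alpha)=\sum_{0\le k\le\lfloor m/2\rfloor}p_{m,m-2k}(n)\cot^{m-2k}\alpha .$$ Moreover, for every integer $n\ge 2$ the coefficients $p_{m,m-2k}(n)$ are positive integers.
   Context: For integers $m\ge1$, $n\ge2$ and real $\alpha\notin\pi\mathbb{Z}$, $S(m,n,\alpha)=\sum_{k=0}^{n-1}\cot^m\frac{\alpha+k\pi}{n}$. $J_n$ is the $n\times n$ all-ones matrix, and $B_n=i\,M$ where $M$ is the $n\times n$ matrix with zero diagonal, entries $1$ above the diagonal and $-1$ below the diagonal. *)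

(* Defs.v *)
From HB Require Import structures.
From mathcomp Require Import all_boot all_order all_algebra.
From mathcomp Require Import reals trigo.
From mathcomp Require Import complex.
Set Implicit Arguments. Unset Strict Implicit. Unset Printing Implicit Defensive.
Import Order.TTheory GRing.Theory Num.Theory.
Local Open Scope ring_scope.

Definition cot (R : realType) (x : R) : R := cos x / sin x.

Definition Ssum (R : realType) (m n : nat) (alpha : R) : R :=
  \sum_(k < n) cot ((alpha + k%:R * pi) / n%:R) ^+ m.

Definition Jmx (R : realType) (n : nat) : 'M[R[i]]_n := const_mx 1.

Definition Mmx (R : realType) (n : nat) : 'M[R[i]]_n :=
  \matrix_(i < n, j < n) (if (i < j)%N then 1 else if (j < i)%N then -1 else 0).
Definition Bmx (R : realType) (n : nat) : 'M[R[i]]_n :=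
  (Complex 0 1) *: Mmx R n.

(* Main.v *)
(* (i) The vectors (w^j)_j with w = e^(-2 i theta), theta = (alpha + k pi) / n, are
   eigenvectors of cot(alpha) J + B with eigenvalues cot theta; these are distinct,
   so the trace of the m-th power is the power sum of the eigenvalues.

   (ii) Write cot(alpha) J + B = i T with T = X J + M at X = - i cot(alpha), and view
   tau_m = tr T^m as a polynomial in X with integer coefficients.  The identity
   T^2 - 1 = n (X^2 - 1) J + 2 [T, diag(0, ..., n-1)], traced against T^(m-1), together with
   tau_m' = m tr(J T^(m-1)) gives
     tau_(m+1) = tau_(m-1) + (n / m) (X^2 - 1) tau_m',
   so the coefficients of tau_m are rational polynomials in n; being integers at all
   natural numbers, they are integers at all integers.  For the signs, the coefficients of
   u^T T^a u (u the all-ones vector) are sums of products of the numbers u^T M^b u, which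
   vanish for odd b and equal (-1)^(b/2) |M^(b/2) u|^2 for even b, as M is skew-symmetric;
   the constant term tr M^m is treated in the same way. *)
Require Import Defs.
From HB Require Import structures.
From mathcomp Require Import all_boot all_order all_algebra.
From mathcomp Require Import reals trigo.
From mathcomp Require Import complex.
From mathcomp Require Import ring zify.
Import Order.TTheory GRing.Theory Num.Theory.
Local Open Scope ring_scope.
Set Implicit Arguments.
Unset Strict Implicit.

(** * The sign matrix [M], the matrix [x J + M] and its square *)

Definition mu (i j : nat) : int :=
  if (i < j)%N then 1 else if (j < i)%N then -1 else 0.

Definition toep (R : comNzRingType) (n : nat) (x : R) : 'M[R]_n :=
  \matrix_(i, j) (x + (mu i j)%:~R).

Lemma map_toep (R S : comNzRingType) (f : {rmorphism R -> S}) n (x : R) :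
  map_mx f (toep n x) = toep n (f x).
Proof. by apply/matrixP => i j; rewrite !mxE rmorphD rmorph_int. Qed.

Lemma sum_muM (R : comNzRingType) (n r : nat) (f : nat -> R) : (r < n)%N ->
  \sum_(0 <= j < n) (mu r j)%:~R * f j =
  \sum_(r.+1 <= j < n) f j - \sum_(0 <= j < r) f j.
Proof.
move=> rn; rewrite (big_cat_nat (leq0n r) (ltnW rn)) /= (big_ltn rn).
rewrite {2}/mu ltnn mul0r add0r addrC -sumrN; congr (_ + _).
  by apply: eq_big_nat => j /andP[rj _]; rewrite /mu rj mul1r.
apply: eq_big_nat => j /andP[_ jr].
by rewrite /mu jr ltnNge (ltnW jr) mulN1r.
Qed.

Lemma sum_mu (n s : nat) (a : nat) : (a <= n)%N ->
  \sum_(a <= j < n) mu j s =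
  (if (n <= s)%N then n%:Z else s%:Z *+ 2 + 1 - n%:Z)
  - (if (a <= s)%N then a%:Z else s%:Z *+ 2 + 1 - a%:Z).
Proof.
(* A tent function with increments [mu j s], so the sum telescopes. *)
move=> an; pose G j := if (j <= s)%N then j%:Z else s%:Z *+ 2 + 1 - j%:Z.
have muE j : mu j s = G j.+1 - G j.
  by rewrite /mu /G; case: ltngtP => ?; lia.
by rewrite (eq_bigr _ (fun j _ => muE j)) telescope_sumr.
Qed.

Lemma sum_mur (n r : nat) : (r < n)%N ->
  \sum_(0 <= j < n) mu r j = n%:Z - 1 - r%:Z *+ 2.
Proof.
move=> rn; have := sum_muM (fun=> 1 : int) rn.
rewrite !big_const_nat !iter_addr_0 subn0 => sE.
under eq_bigr do rewrite -[mu r _]intz -[_%:~R]mulr1.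
by rewrite sE; lia.
Qed.

(** These are the entries of [M^2]. The last term is [2|s - r|], twice an entry of the commutator of
    [M] with [diag(0, ..., n-1)]. *)
Lemma sum_mu_mu (n r s : nat) : (r < n)%N -> (s < n)%N ->
  \sum_(0 <= j < n) mu r j * mu j s =
  (r == s)%:Z - n%:Z + mu r s * (s%:Z - r%:Z) *+ 2.
Proof.
move=> rn sn.
under eq_bigr do rewrite -[mu r _]intz.
rewrite sum_muM // !sum_mu // /mu.
by case: (ltngtP r s) => ?; repeat case: leqP => ?; lia.
Qed.

Definition idx (R : comNzRingType) (n : nat) : 'M[R]_n :=
  diag_mx (\row_j (j : nat)%:R).

(* The commutator on the right is traceless against every power of [toep n x]. *)
Lemma toep_sqr (R : comNzRingType) n (x : R) :
  toep n x *m toep n x = 1%:M + (n%:R * (x ^+ 2 - 1)) *: const_mx 1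
    + (toep n x *m idx R n - idx R n *m toep n x) *+ 2.
Proof.
apply/matrixP => i j.
rewrite mulr2n mul_mx_diag mul_diag_mx !mxE.
under eq_bigr => k _ do rewrite !mxE mulrDl !mulrDr -intrM.
rewrite !big_split /= -!mulr_suml -!mulr_sumr sumr_const card_ord.
rewrite -!rmorph_sum /=.
rewrite -(big_mkord xpredT (fun k => mu k j)) -(big_mkord xpredT (fun k => mu i k)).
rewrite -(big_mkord xpredT (fun k => mu i k * mu k j)) sum_mu_mu //.
rewrite sum_mu //.
rewrite sum_mur // [(n <= j)%N]leqNgt ltn_ord /=.
rewrite -val_eqE /=.
case: (i == j :> nat); rewrite !(rmorphM, rmorphD, rmorphB, rmorphMn, rmorph1, rmorph0,
  rmorphN) /= -!pmulrn; ring.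
Qed.

Lemma tr_toep_exp (R : comNzRingType) n (x : R) a :
  \tr (toep n x ^+ a.+2) =
  \tr (toep n x ^+ a) + n%:R * (x ^+ 2 - 1) * \tr (const_mx 1 *m toep n x ^+ a).
Proof.
set T := toep n x.
have comm_tr0 : \tr ((T *m idx R n - idx R n *m T) *m T ^+ a) = 0.
  rewrite mulmxBl raddfB /= mxtrace_mulC mulmxA -[X in _ - \tr X]mulmxA.
  by rewrite [X in _ - X]mxtrace_mulC !mulmxE -exprSr -exprS subrr.
rewrite -addn2 addnC exprD expr2 -!mulmxE toep_sqr -scaler_nat !mulmxDl mul1mx.
by rewrite -!scalemxAl !mxtraceD !mxtraceZ comm_tr0 mulr0 addr0.
Qed.

(** * Derivatives of traces of powers and the recursion for [tau] *)

Lemma map_deriv_mul (R : comNzRingType) m n p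
    (A : 'M[{poly R}]_(m, n)) (B : 'M[{poly R}]_(n, p)) :
  map_mx deriv (A *m B) = map_mx deriv A *m B + A *m map_mx deriv B.
Proof.
apply/matrixP => i j; rewrite !mxE raddf_sum -big_split /=.
by apply: eq_bigr => k _; rewrite !mxE derivM.
Qed.

(** [A] need not commute with its derivative, but the trace lets each differentiated factor rotate
    to the front. The spare factor [A ^+ k] carries the induction. *)
Lemma tr_map_deriv_exp (R : comNzRingType) n (A : 'M[{poly R}]_n) m k :
  \tr (map_mx deriv (A ^+ m.+1) *m A ^+ k) =
  m.+1%:R * \tr (map_mx deriv A *m A ^+ (m + k)).
Proof.
elim: m k => [|m IHm] k; first by rewrite expr1 mul1r.
rewrite exprS -mulmxE map_deriv_mul mulmxDl mxtraceD -!mulmxA.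
rewrite [X in _ + X]mxtrace_mulC -[X in _ + \tr X]mulmxA !mulmxE -exprSr -exprD.
by rewrite -mulmxE IHm addSnnS [in RHS]mulrSr mulrDl mul1r addrC.
Qed.

Lemma deriv_tr_exp (R : comNzRingType) n (A : 'M[{poly R}]_n) m :
  (\tr (A ^+ m.+1))^`() = m.+1%:R * \tr (map_mx deriv A *m A ^+ m).
Proof.
have := tr_map_deriv_exp A m 0; rewrite expr0 mulmx1 addn0 => <-.
by rewrite raddf_sum; apply: eq_bigr => i _; rewrite !mxE.
Qed.

Definition tau (n m : nat) : {poly int} := \tr (toep n 'X ^+ m).
(* [u^T M^b T^a u] for the all-ones vector u. *)
Definition gam (n b a : nat) : {poly int} :=
  \sum_i \sum_j (toep n (0 : {poly int}) ^+ b * toep n 'X ^+ a) i j.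

Lemma tr_const_mx1_mul (R : comNzRingType) n (A : 'M[R]_n) :
  \tr (const_mx 1 *m A) = \sum_i \sum_j A i j.
Proof.
rewrite exchange_big; apply: eq_bigr => i _; rewrite !mxE.
by apply: eq_bigr => j _; rewrite !mxE mul1r.
Qed.

(** The entrywise derivative of [toep n 'X] is the all-ones matrix. *)
Lemma tau_deriv n m : (tau n m.+1)^`() = m.+1%:R * gam n 0 m.
Proof.
rewrite /tau deriv_tr_exp /gam expr0 mul1r -tr_const_mx1_mul.
congr (_ * \tr (_ *m _)); apply/matrixP => i j; rewrite !mxE.
by rewrite derivD derivX -[_%:~R]mulr1 mulrzl derivMz -[1]/(1%:P) derivC mul0rz addr0.
Qed.

Lemma tauSS n m :
  m.+1%:R * tau n m.+2 =
  m.+1%:R * tau n m + n%:R * ('X ^+ 2 - 1) * (tau n m.+1)^`().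
Proof.
rewrite /tau tr_toep_exp tau_deriv /gam expr0 mul1r -tr_const_mx1_mul; ring.
Qed.

(** At [j = 0] the truncated [j.-1] is [0], as it should be: [X^2 tau'] has no constant term. *)
Lemma coef_tauSS n m j :
  m.+1%:R * (tau n m.+2)`_j = m.+1%:R * (tau n m)`_j +
   n%:R * (j.-1%:R * (tau n m.+1)`_j.-1 - j.+1%:R * (tau n m.+1)`_j.+1).
Proof.
have tauE : m.+1%:R * tau n m.+2 = m.+1%:R * tau n m +
   n%:R * ((tau n m.+1)^`() * 'X^2 - (tau n m.+1)^`()).
  by rewrite tauSS; ring.
have := congr1 (fun p : {poly int} => p`_j) tauE.
rewrite /= !mulr_natl !(coefD, coefMn, coefN, coefMXn, coef_deriv).
by case: j => [|[|j]] //= ->; rewrite ?subSS subn0.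
Qed.

(** * Quadratic forms in powers of a skew-symmetric integer matrix *)

Lemma tr_gram (n p : nat) (W : 'M[int]_(n, p)) :
  0 <= \tr (W^T *m W) ?= iff (W == 0).
Proof.
have -> : \tr (W^T *m W) = \sum_i \sum_j W j i ^+ 2.
  by apply: eq_bigr => i _; rewrite mxE; apply: eq_bigr => j _; rewrite mxE.
split; first by do 2!(apply: sumr_ge0 => ? _); apply: sqr_ge0.
apply/eqP/eqP => [W0|->]; last first.
  by rewrite !big1 // => i _; rewrite big1 // => j _; rewrite mxE expr0n.
apply/matrixP => j i; rewrite mxE; apply/eqP; rewrite -sqrf_eq0.
have := psumr_eq0P (fun i _ => sumr_ge0 _ (fun j _ => sqr_ge0 (W j i))) (esym W0).
move=> /(_ i isT) /(psumr_eq0P (fun j _ => sqr_ge0 (W j i))) /(_ j isT) ->.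
by [].
Qed.

(* The real part of i^d. *)
Definition isgn (d : nat) : int := if odd d then 0 else (-1) ^+ d./2.

Lemma trmx_exp (R : comNzRingType) n (A : 'M[R]_n) k : (A ^+ k)^T = A^T ^+ k.
Proof.
elim: k => [|k IHk]; first by rewrite !expr0 trmx1.
by rewrite exprS -mulmxE trmx_mul IHk mulmxE -exprSr.
Qed.

Section SkewPowers.
Variables (n p : nat) (M : 'M[int]_n) (V : 'M[int]_(n, p)).
Hypotheses (skewM : M^T = - M) (MV_neq0 : M *m V != 0).

Lemma trmx_skew_exp k : (M ^+ k)^T = (-1) ^+ k *: M ^+ k.
Proof.
rewrite trmx_exp skewM; elim: k => [|k IHk]; first by rewrite !expr0 scale1r.
by rewrite exprS IHk !exprS -!mulmxE mulNmx -scalemxAr mulN1r scaleNr.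
Qed.

Lemma tr_skew_even k : \tr (V^T *m M ^+ k.*2 *m V) =
  (-1) ^+ k * \tr ((M ^+ k *m V)^T *m (M ^+ k *m V)).
Proof.
rewrite trmx_mul trmx_skew_exp -scalemxAr -!scalemxAl mxtraceZ mulrA -expr2 sqrr_sign.
by rewrite mul1r -addnn exprD -mulmxE !mulmxA.
Qed.

(* If M^(k+2) V = 0 then |M^(k+1) V|^2 = +- tr (V^T M^k M^(k+2) V) = 0. *)
Lemma skew_exp_neq0 k : M ^+ k *m V != 0.
Proof.
case: k => [|k].
  by apply: contraNneq MV_neq0; rewrite expr0 mul1mx => ->; rewrite mulmx0.
elim: k => [|k IHk]; first by rewrite expr1.
apply: contraNneq IHk => MV0.
have := tr_skew_even k.+1.
have -> : M ^+ k.+1.*2 = M ^+ k *m M ^+ k.+2.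
  by rewrite mulmxE -exprD -addnn addSnnS.
rewrite -(mulmxA V^T) -(mulmxA (M ^+ k)) MV0 !mulmx0 mxtrace0 => /eqP.
by rewrite eq_sym mulf_eq0 signr_eq0 /= eq_sym (tr_gram _).
Qed.


(** For odd [b] the form is minus its transpose; for even [b] it is a signed nonzero Gram trace. It
    serves [V] the all-ones column and [V = 1]. The factor [isgn b] records vanishing and strict
    sign together. *)
Lemma tr_skew_exp b : exists2 q : int, 0 < q & \tr (V^T *m M ^+ b *m V) = isgn b * q.
Proof.
rewrite /isgn; case: ifPn => [odd_b|/even_halfK <-].
  exists 1 => //; rewrite mul0r; set x := \tr _.
  suff : x = - x by lia.
  rewrite /x -{1}mxtrace_tr !trmx_mul trmxK trmx_skew_exp -signr_odd odd_b.
  by rewrite scaleN1r mulNmx mulmxN mulmxA raddfN.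
rewrite doubleK; exists (\tr ((M ^+ b./2 *m V)^T *m (M ^+ b./2 *m V))).
  by rewrite lt_def eq_sym !(tr_gram _) skew_exp_neq0.
exact: tr_skew_even.
Qed.
End SkewPowers.

(** * Signs of the coefficients of [gam] and [tau] *)

Lemma trmx_toep0 n : (toep n (0 : int))^T = - toep n 0.
Proof.
by apply/matrixP => i j; rewrite !mxE !add0r !intz /mu; case: ltngtP.
Qed.

Lemma toep0_mul_const_neq0 n : (2 <= n)%N ->
  toep n (0 : int) *m const_mx 1 != 0 :> 'cV_n.
Proof.
case: n => // n n_gt0; apply/eqP => /matrixP/(_ ord0 ord0).
rewrite !mxE; under eq_bigr do rewrite !mxE add0r mulr1 intz.
by rewrite -(big_mkord xpredT (mu 0%N)) sum_mur //; lia.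
Qed.

Lemma toep0_mul1_neq0 n : (2 <= n)%N -> toep n (0 : int) *m 1%:M != 0.
Proof.
case: n => [|[|n]] // _; apply/eqP => /matrixP/(_ ord0 ord_max).
by rewrite mulmx1 !mxE.
Qed.

Lemma sum_entriesE (R : comNzRingType) n (A : 'M[R]_n) :
  \sum_i \sum_j A i j = \tr ((const_mx 1 : 'cV_n)^T *m A *m const_mx 1).
Proof.
rewrite mxtrace_mulC mulmxA -tr_const_mx1_mul; congr (\tr (_ *m _)).
by apply/matrixP => i j; rewrite !mxE big_ord1 !mxE mulr1.
Qed.

Lemma gam0 n b : gam n b 0 = (\sum_i \sum_j (toep n (0 : int) ^+ b) i j)%:P.
Proof.
rewrite /gam -[0 in LHS]/(polyC 0) -map_toep expr0 mulr1 -rmorphXn rmorph_sum.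
apply: eq_bigr => i _; rewrite rmorph_sum; apply: eq_bigr => j _.
by rewrite mxE.
Qed.

(* Expands the leftmost factor [T = X u u^T + M] of [T^(a+1)]. *)
Lemma gamS n b a : gam n b a.+1 = 'X * gam n b 0 * gam n 0 a + gam n b.+1 a.
Proof.
rewrite /gam !sum_entriesE expr0 mulr1 mul1r.
set T0 := toep n 0; set T := toep n 'X; set u : 'cV[{poly int}]_n := const_mx 1.
have TE : T = 'X *: (u *m u^T) + T0.
  apply/matrixP => i j; rewrite !mxE big_ord1 !mxE; ring.
have -> : T0 ^+ b * T ^+ a.+1 =
    'X *: (T0 ^+ b *m u *m (u^T *m T ^+ a)) + T0 ^+ b.+1 *m T ^+ a.
  rewrite exprS {1}TE exprSr -!mulmxE mulmxDl mulmxDr -scalemxAl -scalemxAr.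
  by rewrite !mulmxA.
rewrite mulmxDr mulmxDl mxtraceD -scalemxAr -scalemxAl mxtraceZ; congr (_ + _).
rewrite -mulrA; congr (_ * _).
have -> : u^T *m (T0 ^+ b *m u *m (u^T *m T ^+ a)) *m u =
   (u^T *m T0 ^+ b *m u) *m (u^T *m T ^+ a *m u) by rewrite !mulmxA.
by rewrite /mxtrace !big_ord1 mxE big_ord1.
Qed.


(** For even [b], [i^b] is real and factors out of the real part. *)
Lemma isgnD b d : ~~ odd b -> isgn (b + d) = isgn b * isgn d.
Proof.
move=> even_b; rewrite /isgn oddD (negPf even_b) halfD (negPf even_b) add0n exprD /=.
by case: odd; rewrite ?mulr0.
Qed.

(** Induction on [a] by [gamS], with [b] general because [gamS] raises it. The two summands never
    have opposite signs: for even [b] they agree, for odd [b] the product term vanishes. *)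
Lemma coef_gam n a b j : (2 <= n)%N ->
  if (j <= a)%N then exists2 q : int, 0 < q & (gam n b a)`_j = isgn (b + a - j) * q
  else (gam n b a)`_j = 0.
Proof.
move=> n_ge2.
have gam0_coef c k : 
  if (k <= 0)%N then exists2 q : int, 0 < q & (gam n c 0)`_k = isgn c * q
  else (gam n c 0)`_k = 0.
  rewrite gam0 coefC; case: k => //=; rewrite sum_entriesE.
  exact: tr_skew_exp (trmx_toep0 n) (toep0_mul_const_neq0 n_ge2) c.
elim: a b j => [|a IHa] b j.
  by have := gam0_coef b j; rewrite addn0; case: j => //=; rewrite subn0.
rewrite gamS gam0 -mulrA coefD mulrC -mulrA coefCM coefMX.
have := gam0_coef b 0; rewrite /= gam0 coefC /= => -[s s_gt0 ->].
case: j => [|j] /=.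
  have [q q_gt0 ->] := IHa b.+1 0%N; exists q => //.
  by rewrite mulr0 add0r addSnnS.
rewrite ltnS addnS subSS; have := IHa 0%N j; have := IHa b.+1 j.+1; rewrite add0n.
case: (ltngtP j a) => [ja|aj|->].
- have -> : (b.+1 + a - j.+1 = b + a - j)%N by lia.
  move=> [q q_gt0 ->] [q' q'_gt0 ->]; have [odd_b|even_b] := boolP (odd b).
    by exists q => //; rewrite /isgn odd_b; ring.
  exists (s * q' + q); first by rewrite addr_gt0 ?mulr_gt0.
  by rewrite -addnBA ?(ltnW ja) // isgnD //; ring.
- by move=> -> ->; rewrite !mulr0.
(* Top degree: only the product term survives. *)
- move=> -> [q q_gt0 ->]; rewrite subnn addnK.
  by exists (s * q); rewrite ?mulr_gt0 // /isgn /=; ring.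
Qed.

(** One integer polynomial serves all rings: it is evaluated at [0] in [int] for the constant term
    and at [- i cot alpha] in [R[i]] for the trace. *)
Lemma tau_horner (R : comNzRingType) n m (x : R) :
  (map_poly intr (tau n m)).[x] = \tr (toep n x ^+ m).
Proof.
have evX : map_mx (horner_eval x) (toep n 'X) = toep n x.
  by rewrite map_toep /= /horner_eval hornerX.
rewrite /tau -trace_map_mx rmorphXn /= map_toep /= map_polyX.
by rewrite -[LHS]/(horner_eval x _) -trace_map_mx rmorphXn /= evX.
Qed.

Lemma coef_tau n m j : (2 <= n)%N ->
  if (j <= m)%N then exists2 q : int, 0 < q & (tau n m)`_j = isgn (m - j) * q
  else (tau n m)`_j = 0.
Proof.
move=> n_ge2; case: j => [|j].
  rewrite subn0; have [q q_gt0 qE] := tr_skew_exp (trmx_toep0 n) (toep0_mul1_neq0 n_ge2) m.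
  exists q => //; rewrite -qE trmx1 mul1mx mulmx1 /tau.
  by rewrite -(tau_horner n m (0 : int)) horner_coef0 coef_map_id0 // intz.
case: m => [|m].
  by rewrite /tau expr0 mxtrace1 -polyC_natr coefC.
have := coef_gam m 0 j n_ge2; rewrite add0n subSS ltnS.
have /(congr1 (fun p : {poly int} => p`_j)) := tau_deriv n m.
rewrite /= mulr_natl coef_deriv coefMn -[_ *+ j.+1]mulr_natr -[_ *+ m.+1]mulr_natr.
case: ifP => jm tauE.
  move=> [q q_gt0 gamE]; move: tauE; rewrite gamE /isgn.
  case: ifPn => _ tauE.
    (* The sign factor is [0] here, so any positive witness will do. *)
    exists 1 => //; move/eqP: tauE; rewrite !mul0r mulf_eq0.
    by rewrite pnatr_eq0 orbF => /eqP.
  set s := (-1) ^+ _ in tauE *; have ss : s * s = 1 by rewrite -expr2 sqrr_sign.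
  exists (s * (tau n m.+1)`_j.+1); last by rewrite mulrA ss mul1r.
  rewrite -(pmulr_lgt0 _ (ltr0Sn _ j)) -mulrA tauE.
  by rewrite !mulrA ss mul1r mulr_gt0 // ltr0n.
move=> gamE; move/eqP: tauE.
by rewrite gamE mul0r mulf_eq0 pnatr_eq0 orbF => /eqP.
Qed.

(** * Polynomial dependence on [n] and integrality *)

Lemma tau_poly m : exists P : nat -> {poly rat},
  forall n j, (P j).[n%:R] = ((tau n m)`_j)%:~R.
Proof.
pose H m := exists P : nat -> {poly rat},
  forall n j, (P j).[n%:R] = ((tau n m)`_j)%:~R.
suff : H m /\ H m.+1 by case.
elim: m => [|m [[P PE] [Q QE]]].
  split.
    (* In the witnesses ['X] stands for [n]: [tau n 0] is the constant [n], and [tau n 1] is [n]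
       times its variable. *)
    exists (fun j => if j is 0%N then 'X else 0) => n j.
    rewrite /tau expr0 mxtrace1 -polyC_natr coefC.
    by case: j => [|j] /=; rewrite ?hornerX ?horner0 // natz.
  exists (fun j => if j is 1%N then 'X else 0) => n j.
  have -> : tau n 1 = n%:R * 'X.
    rewrite /tau expr1 /mxtrace.
    under eq_bigr do rewrite mxE /mu ltnn addr0.
    by rewrite sumr_const card_ord mulr_natl.
  rewrite mulr_natl coefMn coefX.
  by case: j => [|[|j]] /=; rewrite ?hornerX ?horner0 ?mul0rn // natz.
split; first by exists Q.
exists (fun j => P j + (m.+1%:R^-1)%:P * 'X *
  (j.-1%:R%:P * Q j.-1 - j.+1%:R%:P * Q j.+1)) => n j.
rewrite hornerD !hornerM hornerX hornerD hornerN !hornerM !hornerC !PE !QE.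
apply: (mulfI (_ : m.+1%:R != 0)); first by rewrite pnatr_eq0.
have -> : m.+1%:R * ((tau n m.+2)`_j)%:~R = (m.+1%:R * (tau n m.+2)`_j)%:~R :> rat.
  by rewrite rmorphM rmorph_nat.
rewrite coef_tauSS !(rmorphM, rmorphD, rmorphN, rmorph_nat) /= mulrDr !mulrA.
by rewrite divff ?pnatr_eq0 // mul1r mulrBr !mulrA.
Qed.

(** Induction on the degree: [p(X+1) - p(X)] has smaller degree and is integral on naturals, hence
    on all integers. Stepping from [p(0)] then reaches every integer. *)
Lemma horner_int_of_nat (p : {poly rat}) :
  (forall n : nat, p.[n%:R] \is a Num.int) ->
  forall x : int, p.[x%:~R] \is a Num.int.
Proof.
have [s] := ubnP (size p); elim: s p => // s IHs p; rewrite ltnS => size_p p_nat.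
have [size_p1|size_p1] := leqP (size p) 1.
  move=> x; have := p_nat 0%N.
  by rewrite (size1_polyC size_p1) !hornerC.
have diff_int x : p.[(x + 1)%:~R] - p.[x%:~R] \is a Num.int.
  pose q := p \Po ('X + 1%:P) - p.
  have qE y : q.[y] = p.[y + 1] - p.[y].
    by rewrite hornerD hornerN horner_comp hornerD hornerX hornerC.
  have -> : p.[(x + 1)%:~R] - p.[x%:~R] = q.[x%:~R] by rewrite qE intrD.
  apply: IHs => [|n]; last by rewrite qE rpredB // natr1 p_nat.
  apply: leq_trans size_p; rewrite -(prednK (ltnW size_p1)) ltnS.
  have size_X1 : size ('X + 1%:P : {poly rat}) = 2 by rewrite size_XaddC.
  apply/leq_sizeP => j pj; rewrite coefB.
  (* The shift preserves the leading coefficient, so the top terms cancel. *)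
  have [->|p_neq_j] := eqVneq j (size p).-1.
    rewrite -{1}(size_comp_poly2 p size_X1) -![_`_(size _).-1]lead_coefE.
    by rewrite lead_coef_comp ?size_X1 // lead_coefXaddC expr1n mulr1 subrr.
  have sj : (size p <= j)%N by lia.
  by rewrite !nth_default ?subrr ?size_comp_poly2.
elim=> [|n IHn|n IHn].
- exact: (p_nat 0%N).
- by have := rpredD (diff_int n) IHn; rewrite subrK -PoszD addn1.
- have := rpredB IHn (diff_int (- n.+1%:Z)).
  have -> : - n.+1%:Z + 1 = - n%:Z by lia.
  by rewrite opprB addrC subrK.
Qed.

(** * Eigenvectors of [toep] and traces of its powers *)

Lemma diag_mx_exp (R : comNzRingType) n (d : 'rV[R]_n) m :
  diag_mx d ^+ m = diag_mx (\row_j d 0 j ^+ m).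
Proof.
elim: m => [|m IHm].
  by rewrite expr0; apply/matrixP => i j; rewrite !mxE expr0.
rewrite exprS IHm -mulmxE mulmx_diag; congr diag_mx.
by apply/rowP => j; rewrite !mxE exprS.
Qed.

Lemma tr_exp_diagonalizable (F : fieldType) n (A V : 'M[F]_n) (d : 'rV[F]_n) m :
  V \in unitmx -> A *m V = V *m diag_mx d -> \tr (A ^+ m) = \sum_k d 0 k ^+ m.
Proof.
move=> V_unit AV.
have AmV : A ^+ m *m V = V *m diag_mx d ^+ m.
  elim: m => [|m IHm]; first by rewrite !expr0 mul1mx mulmx1.
  by rewrite exprS -mulmxE -mulmxA IHm mulmxA AV -mulmxA mulmxE -exprS.
rewrite -[A ^+ m](mulmxK V_unit) AmV mxtrace_mulC mulmxA mulVmx // mul1mx.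
by rewrite diag_mx_exp mxtrace_diag; apply: eq_bigr => k _; rewrite mxE.
Qed.

Lemma sum_geom (R : comNzRingType) (w : R) a b : (a <= b)%N ->
  (w - 1) * (\sum_(a <= j < b) w ^+ j) = w ^+ b - w ^+ a.
Proof.
move=> ab; rewrite -(telescope_sumr (fun j => w ^+ j) ab) mulr_sumr.
by apply: eq_bigr => j _; rewrite mulrBl mul1r -exprS.
Qed.

(** Multiplying by [w - 1] collapses the geometric sums. The terms free of [r] cancel by the
    equation for [w ^+ n], leaving [-(1 + w) w^r]. *)
Lemma toep_eigenvector (F : idomainType) n (x w l : F) (r : 'I_n) :
  w != 1 -> l * (w - 1) = - (1 + w) -> w ^+ n * (x + 1) = x - 1 ->
  \sum_(j < n) toep n x r j * w ^+ j = l * w ^+ r.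
Proof.
move=> w_neq1 lw wn; apply: (@mulfI _ (w - 1)); first by rewrite subr_eq0.
under eq_bigr do rewrite mxE mulrDl.
rewrite big_split /= -mulr_sumr.
rewrite -(big_mkord xpredT (fun j => w ^+ j)).
rewrite -(big_mkord xpredT (fun j => (mu r j)%:~R * w ^+ j)) sum_muM //.
rewrite mulrDr mulrBr mulrCA !sum_geom // !expr0 mulrCA mulrA [_ * (w - 1)]mulrC.
have {}wn : x * w ^+ n = x - 1 - w ^+ n by rewrite -wn; ring.
by rewrite [(w - 1) * l]mulrC lw exprS mulrBr wn; ring.
Qed.

(* The eigenvalue l k belongs to the eigenvector (w^j)_j with w = (l k - 1) / (l k + 1). *)
Lemma tr_toep_exp_eigen (F : numFieldType) n (x : F) (l : 'I_n -> F) m :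
  injective l -> (forall k, l k + 1 != 0) ->
  (forall k, (l k - 1) ^+ n * (x + 1) = (l k + 1) ^+ n * (x - 1)) ->
  \tr (toep n x ^+ m) = \sum_k l k ^+ m.
Proof.
move=> l_inj l_neq lE; pose w k := (l k - 1) / (l k + 1).
have wE k : w k * (l k + 1) = l k - 1 by rewrite divfK.
have w_neq1 k : w k != 1.
  apply/eqP => w1; have := wE k; rewrite w1 mul1r => lk.
  have : 2 = 0 :> F by transitivity (l k + 1 - (l k - 1)); [ring | rewrite lk subrr].
  by move/eqP; rewrite pnatr_eq0.
have w_inj : injective w.
  move=> j k wjk; apply: l_inj.
  have : (l j - l k) * 2 = 0.
    transitivity ((l j - 1) * (l k + 1) - (l k - 1) * (l j + 1)); first by ring.
    by rewrite -!wE wjk; ring.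
  by move/eqP; rewrite mulf_eq0 pnatr_eq0 orbF subr_eq0 => /eqP.
have -> : \sum_k l k ^+ m = \sum_k (\row_j l j) 0 k ^+ m.
  by apply: eq_bigr => k _; rewrite mxE.
apply: (@tr_exp_diagonalizable _ _ _ (Vandermonde n (\row_j w j))).
  rewrite unitmxE unitfE det_Vandermonde.
  apply/prodf_neq0 => i _; apply/prodf_neq0 => j ij.
  by rewrite !mxE subr_eq0 (inj_eq w_inj) -val_eqE /= gtn_eqF.
apply/matrixP => i k; rewrite mul_mx_diag !mxE.
under eq_bigr do rewrite [Vandermonde _ _ _ _]mxE [(\row__ _) _ _]mxE.
rewrite (@toep_eigenvector _ _ _ _ (l k)) 1?mulrC //.
  apply/eqP; rewrite -subr_eq0 opprK; apply/eqP.
  by transitivity (w k * (l k + 1) - (l k - 1)); [ring | rewrite wE subrr].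
apply: (@mulfI _ ((l k + 1) ^+ n)); first by rewrite expf_neq0.
by rewrite mulrCA -exprMn [_ * w k]mulrC wE mulrC lE.
Qed.

(** * Cotangents at the nodes and the trace formula *)

Section Spectrum.
Variable R : realType.
Implicit Types (x theta alpha : R) (k n : nat).

Lemma sinDnpi x k : sin (x + k%:R * pi) = (-1) ^+ k * sin x.
Proof.
elim: k => [|k IHk]; first by rewrite mul0r addr0 mul1r.
by rewrite -natr1 mulrDl mul1r addrA sinDpi IHk exprS mulN1r mulNr.
Qed.

Lemma cosDnpi x k : cos (x + k%:R * pi) = (-1) ^+ k * cos x.
Proof.
elim: k => [|k IHk]; first by rewrite mul0r addr0 mul1r.
by rewrite -natr1 mulrDl mul1r addrA cosDpi IHk exprS mulN1r mulNr.
Qed.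

(** Subtracting [floor(x / pi) pi] lands in [[0, pi)], where sine vanishes only at [0]. *)
Lemma sin_eq0_pi x : sin x = 0 -> exists z : int, x = z%:~R * pi.
Proof.
have pi_neq0 : pi != 0 :> R by rewrite gt_eqF ?pi_gt0.
move=> sinx; exists (Num.floor (x / pi)); set z := Num.floor _.
have [y0 y1] : 0 <= x - z%:~R * pi /\ x - z%:~R * pi < pi.
  have := floor_itv (x / pi); rewrite -/z => /andP[].
  rewrite ler_pdivlMr ?pi_gt0 // ltr_pdivrMr ?pi_gt0 // intrD mulrDl mul1r.
  by rewrite subr_ge0 ltrBlDl.
have siny : sin (x - z%:~R * pi) = 0.
  case: z {y0 y1} => k; last first.
    by rewrite NegzE mulrNz mulNr opprK sinDnpi sinx mulr0.
  have := sinDnpi (x - k%:R * pi) k; rewrite subrK sinx => /esym/eqP.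
  by rewrite mulf_eq0 signr_eq0 => /eqP.
move: y0; rewrite le_eqVlt => /orP[/eqP/esym/eqP|y0].
  by rewrite subr_eq0 => /eqP.
by have := sin_gt0_pi (introT andP (conj y0 y1)); rewrite siny ltxx.
Qed.

Definition cis x : R[i] := Complex (cos x) (sin x).

Lemma cis_exp x n : cis x ^+ n = cis (n%:R * x).
Proof.
elim: n => [|n IHn]; first by rewrite mul0r /cis cos0 sin0.
rewrite exprS IHn -nat1r mulrDl mul1r /cis cosD sinD; simpc.
by congr Complex; rewrite addrC.
Qed.

Lemma cotI_cis x : sin x != 0 -> Complex (cot x) 1 = (sin x)^-1%:C%C * cis x.
Proof. by move=> sx; rewrite /cis /cot; simpc; rewrite mulVf // mulrC. Qed.

Lemma sin_neq0_div theta alpha n k : n%:R * theta = alpha + k%:R * pi ->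
  sin alpha != 0 -> sin theta != 0.
Proof.
move=> nt; apply: contra_neq => s0.
have : sin (n%:R * theta) = 0.
  elim: n {nt} => [|n IHn]; first by rewrite mul0r sin0.
  by rewrite -nat1r mulrDl mul1r sinD s0 IHn mul0r mulr0 addr0.
by rewrite nt sinDnpi => /eqP; rewrite mulf_eq0 signr_eq0 => /eqP.
Qed.

(** [cot x + i] is a real multiple of [e^(ix)], and [n theta] equals [alpha] modulo [pi]. Only the
    reality of [r] matters later. *)
Lemma cotI_exp theta alpha n k : n%:R * theta = alpha + k%:R * pi ->
  sin alpha != 0 ->
  exists r : R, Complex (cot theta) 1 ^+ n = r%:C%C * Complex (cot alpha) 1.
Proof.
move=> nt sa; have st := sin_neq0_div nt sa.
exists ((sin theta)^-1 ^+ n * (-1) ^+ k * sin alpha).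
rewrite !cotI_cis // exprMn cis_exp nt /cis sinDnpi cosDnpi -rmorphXn /=.
by simpc; congr Complex; field.
Qed.

(** Both sides equal [r |cot alpha + i|^2]. Up to a power of [-i] this is the eigenvalue equation
    for [l = - i cot theta], [x = - i cot alpha]. *)
Lemma cot_exp_conj theta alpha n k : n%:R * theta = alpha + k%:R * pi ->
  sin alpha != 0 ->
  Complex (cot theta) (-1) ^+ n * Complex (cot alpha) 1 =
  Complex (cot theta) 1 ^+ n * Complex (cot alpha) (-1).
Proof.
move=> nt sa; have [r rE] := cotI_exp nt sa.
have -> : Complex (cot theta) (-1) = conjc (Complex (cot theta) 1) by [].
rewrite -rmorphXn rE rmorphM /=; simpc; congr Complex; ring.
Qed.

(** Equal cotangents give [sin (tk - tj) = 0], yet [0 < tk - tj < pi] when [j < k]. *)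
Lemma cot_node_inj alpha n : sin alpha != 0 ->
  injective (fun k : 'I_n => cot ((alpha + (k : nat)%:R * pi) / n%:R)).
Proof.
move=> sa j k; case: n j k => [[]//|n] j k.
wlog jk : j k / (j < k)%N.
  move=> IH; case: (ltngtP j k) => [/IH//|/IH jk /esym/jk//|/val_inj //].
have n_neq0 : n.+1%:R != 0 :> R by rewrite pnatr_eq0.
have sinE (l : 'I_n.+1) : sin ((alpha + (l : nat)%:R * pi) / n.+1%:R) != 0.
  by apply: (sin_neq0_div (n := n.+1) (k := l) _ sa); rewrite mulrCA divff // mulr1.
rewrite /cot; set tj := (alpha + (j : nat)%:R * pi) / _.
set tk := (alpha + (k : nat)%:R * pi) / _ => tjk.
have : sin (tk - tj) = 0.
  rewrite sinB; have sj := sinE j; have sk := sinE k.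
  have -> : cos tk = cos tj / sin tj * sin tk by rewrite tjk divfK.
  by field.
have -> : tk - tj = (k - j)%:R * pi / n.+1%:R.
  by rewrite /tk /tj -mulrBl natrB ?(ltnW jk) //; congr (_ / _); ring.
move=> s0; suff : 0 < sin ((k - j)%:R * pi / n.+1%:R) :> R by rewrite s0 ltxx.
apply: sin_gt0_pi; rewrite divr_gt0 ?mulr_gt0 ?pi_gt0 ?ltr0n ?subn_gt0 //=.
rewrite ltr_pdivrMr ?ltr0n // mulrC ltr_pM2l ?pi_gt0 // ltr_nat.
by rewrite (leq_ltn_trans (leq_subr _ _)).
Qed.

Lemma scalemx_exp (S : comNzRingType) n (a : S) (A : 'M[S]_n) m :
  (a *: A) ^+ m = a ^+ m *: A ^+ m.
Proof.
elim: m => [|m IHm]; first by rewrite !expr0 scale1r.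
by rewrite !exprS IHm -!mulmxE -scalemxAl -scalemxAr scalerA.
Qed.

Lemma cotJ_add_B n x : Complex x 0 *: Jmx R n + Bmx R n =
  Complex 0 1 *: toep n (Complex 0 (- x)).
Proof.
apply/matrixP => i j; rewrite !mxE /mu.
by case: ltngtP => _; rewrite ?rmorph1 ?rmorph0 ?rmorphN1; simpc.
Qed.

Lemma tr_cotJ_add_B n x m : \tr ((Complex x 0 *: Jmx R n + Bmx R n) ^+ m) =
  Complex 0 1 ^+ m * \tr (toep n (Complex 0 (- x)) ^+ m).
Proof. by rewrite cotJ_add_B scalemx_exp mxtraceZ. Qed.

Lemma Ssum_trace m n alpha : (forall z : int, alpha != z%:~R * pi) ->
  Complex (Ssum m n alpha) 0 =
  \tr ((Complex (cot alpha) 0 *: Jmx R n + Bmx R n) ^+ m).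
Proof.
move=> alpha_npi; have sa : sin alpha != 0.
  by apply/eqP => /sin_eq0_pi [z az]; have := alpha_npi z; rewrite az eqxx.
pose t (k : 'I_n) := cot ((alpha + (k : nat)%:R * pi) / n%:R).
rewrite tr_cotJ_add_B (@tr_toep_exp_eigen _ n _ (fun k : 'I_n => Complex 0 (- t k))).
- rewrite mulr_sumr /Ssum -[LHS]/((_)%:C%C) rmorph_sum /=.
  by apply: eq_bigr => k _; rewrite -exprMn rmorphXn /=; simpc.
- by move=> j k /= [/oppr_inj]; apply: cot_node_inj.
- by move=> k; simpc; rewrite eq_complex /= oner_eq0.
move=> k.
have ntE : n%:R * ((alpha + (k : nat)%:R * pi) / n%:R) = alpha + (k : nat)%:R * pi.
  by rewrite mulrCA divff ?mulr1 // pnatr_eq0; case: (n) k => [[]|].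
have e1 x : Complex 0 (- x) - 1 = Complex 0 (-1) * Complex x (-1) by simpc.
have e2 x : Complex 0 (- x) + 1 = Complex 0 (-1) * Complex x 1 by simpc.
rewrite !e1 !e2 !exprMn -!mulrA; congr (_ * _); rewrite mulrCA [RHS]mulrCA.
by congr (_ * _); apply: (cot_exp_conj ntE sa).
Qed.
End Spectrum.

(** * Expansion in powers of the cotangent *)

Lemma sum_even_index (V : zmodType) (G : nat -> V) m :
  (forall d, (d <= m)%N -> odd d -> G d = 0) ->
  \sum_(d < m.+1) G d = \sum_(k < m./2.+1) G (2 * k)%N.
Proof.
elim: m => [|m IHm] G_odd; first by rewrite !big_ord1.
rewrite big_ord_recr IHm /= => [|d dm]; last exact/G_odd/leqW.
rewrite uphalf_half; have [odd_m|even_m] := boolP (odd m).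
  by rewrite add1n [RHS]big_ord_recr /=; congr (_ + _); congr G; lia.
by rewrite G_odd ?addr0 //= even_m.
Qed.

(** With [d = m - j], odd [d] drop out by [coef_tau]; for [d = 2k] the powers of [i] combine to
    [i^m (-i)^(m-2k) = (-1)^k]. *)
Lemma tr_cotJ_add_B_coef (R : realType) n m (x : R) : (2 <= n)%N ->
  \tr ((Complex x 0 *: Jmx R n + Bmx R n) ^+ m) =
  Complex (\sum_(k < m./2.+1)
    ((-1) ^+ k * (tau n m)`_(m - 2 * k))%:~R * x ^+ (m - 2 * k)) 0.
Proof.
move=> n_ge2; rewrite tr_cotJ_add_B -tau_horner.
have size_tau : (size (map_poly intr (tau n m) : {poly R[i]}) <= m.+1)%N.
  apply/leq_sizeP => j mj; rewrite coef_map_id0 //.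
  by have := coef_tau m j n_ge2; rewrite leqNgt mj /= => ->.
rewrite (horner_coef_wide _ size_tau) mulr_sumr (reindex_inj rev_ord_inj) /=.
pose G d : R[i] := Complex 0 1 ^+ m *
  (((tau n m)`_(m - d))%:~R * Complex 0 (- x) ^+ (m - d)).
transitivity (\sum_(d < m.+1) G d).
  by apply: eq_bigr => d _; rewrite subSS coef_map_id0.
rewrite sum_even_index => [|d dm odd_d]; last first.
  have := coef_tau m (m - d) n_ge2; rewrite leq_subr subKn // => -[q _ tauE].
  by rewrite /G tauE /isgn odd_d !mul0r mulr0.
rewrite -[RHS]/((_)%:C%C) rmorph_sum /=; apply: eq_bigr => k _.
have km : (2 * k <= m)%N by have := ltn_ord k; lia.
have IxE : Complex 0 (- x) = Complex 0 (-1) * x%:C%C by simpc.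
have IE : Complex 0 1 ^+ m = Complex 0 1 ^+ (m - 2 * k) * (-1) ^+ k :> R[i].
  rewrite -{1}(subnK km) exprD exprM; congr (_ * _ ^+ _).
  by rewrite expr2; simpc.
have II : Complex 0 1 * Complex 0 (-1) = 1 :> R[i] by simpc.
rewrite /G IE IxE exprMn -[RHS]/(real_complex R _) rmorphM rmorphXn /=.
rewrite rmorph_int rmorphM /= rmorph_sign.
set N := (m - 2 * k)%N; set t := _%:~R.
transitivity ((-1) ^+ k * t * x%:C%C ^+ N * (Complex 0 1 * Complex 0 (-1)) ^+ N).
  by rewrite exprMn; ring.
by rewrite II expr1n mulr1.
Qed.


Theorem theorem3p1 :
  (forall (R : realType) (m n : nat) (alpha : R),
      (1 <= m)%N -> (2 <= n)%N ->
      (forall z : int, alpha != z%:~R * pi) ->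
      Complex (Ssum m n alpha) 0 =
        \tr ((Complex (cot alpha) 0 *: Jmx R n + Bmx R n) ^+ m))
  /\
  (forall m : nat, (1 <= m)%N ->
    exists p : nat -> {poly rat},
      (forall k, (k <= m./2)%N -> forall x : int, (p k).[x%:~R] \is a Num.int)
      /\ (forall (R : realType) (n : nat) (alpha : R),
            (2 <= n)%N -> (forall z : int, alpha != z%:~R * pi) ->
            Ssum m n alpha =
              \sum_(k < m./2.+1) ratr (p k).[n%:R] * cot alpha ^+ (m - 2 * k))
      /\ (forall n : nat, (2 <= n)%N -> forall k, (k <= m./2)%N ->
            (p k).[n%:R] \is a Num.nat /\ 0 < (p k).[n%:R])).
Proof.
split=> [R m n alpha _ _|m _]; first exact: Ssum_trace.
have [P PE] := tau_poly m.
(* The sign cancels [isgn (2k) = (-1)^k] from [coef_tau], so the values become positive. *)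
pose p k := ((-1) ^+ k)%:P * P (m - 2 * k)%N.
have pE k n : (p k).[n%:R] = ((-1) ^+ k * (tau n m)`_(m - 2 * k))%:~R.
  by rewrite hornerM hornerC PE rmorphM rmorph_sign.
exists p; split=> [k _|]; first by apply: horner_int_of_nat => n; rewrite pE intr_int.
split=> [R n alpha n_ge2 alpha_npi|n n_ge2 k km].
  have := Ssum_trace m n alpha_npi; rewrite tr_cotJ_add_B_coef // => -[->].
  by apply: eq_bigr => k _; rewrite pE ratr_int.
have := coef_tau m (m - 2 * k) n_ge2; rewrite leq_subr => -[q q_gt0 tauE].
have -> : (p k).[n%:R] = q%:~R.
  rewrite pE tauE subKn; last by lia.
  by rewrite /isgn mul2n odd_double doubleK mulrA -expr2 sqrr_sign mul1r.
by rewrite ltr0z q_gt0; case: q q_gt0 {tauE} => // q _; rewrite natr_nat.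
Qed.
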